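(* For any polynomial $P(z)\in\mathbb{C}[z]$ of degree $3$ and any $c\in\mathbb{C}$ that is generic and independent from the coefficients of $P$, the equation $z'=P(z)+c$ is orthogonal to the constants.
   Context: $(\mathcal{U},\delta)$ is a saturated model of $DCF_0$ with field of constants $\mathbb{C}$, $z'=\delta(z)$. ''Generic and independent from the coefficients of $P$'' means that $c$ is transcendental over the field generated over $\mathbb{Q}$ by the coefficients of $P$. Let $K$ be the field generated over $\mathbb{Q}$ by $c$ and the coefficients of $P$. The equation is nonorthogonal to the constants if for some (small) differential field extension $F$ of $K$ in $\mathcal{U}$ there is a solution $a\in\mathcal{U}$ such that the differential field $F\langle a\rangle$ generated by $a$ over $F$ contains a constant not in $F^{alg}$; otherwise it is orthogonal to the constants. *)

(* Defs.v *)
From HB Require Import structures.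
From mathcomp Require Import all_boot all_order all_algebra.
From mathcomp Require Import mpoly.
From mathcomp Require Import mathcomp_extra boolp classical_sets functions.
From mathcomp Require Import cardinality.

Set Implicit Arguments.
Unset Strict Implicit.
Unset Printing Implicit Defensive.

Import GRing.Theory.

Local Open Scope classical_set_scope.
Local Open Scope ring_scope.

(* The first-order language of differential rings (0, 1, +, -, *, derivation),
   expanded with constant symbols indexed by C; DVar i is the i-th variable. *)
Inductive dterm (C : Type) : Type :=
| DVar of nat
| DConst of C
| DZero
| DOne
| DAdd of dterm C & dterm C
| DOpp of dterm C
| DMul of dterm C & dterm C
| DDer of dterm C.

Inductive dformula (C : Type) : Type :=
| DEqual of dterm C & dterm C
| DNot of dformula C
| DAnd of dformula C & dformula C
| DExists of nat & dformula C.

Section Differential.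
Variables (U : fieldType) (delta : {additive U -> U}).
Implicit Types (A F G S : set U) (P : {poly U}) (a c x : U).

Definition leibniz : Prop :=
  forall x y, delta (x * y) = delta x * y + x * delta y.

Section Semantics.
Variables (C : Type) (val : C -> U).

Fixpoint deval (e : seq U) (t : dterm C) : U :=
  match t with
  | DVar i => e`_i
  | DConst k => val k
  | DZero => 0
  | DOne => 1
  | DAdd t1 t2 => deval e t1 + deval e t2
  | DOpp t1 => - deval e t1
  | DMul t1 t2 => deval e t1 * deval e t2
  | DDer t1 => delta (deval e t1)
  end.

(* As in GRing.holds, a variable out of the range of e is interpreted by 0.
   Hence, for e of size n, every formula defines a property of n-tuples,
   its free variables of index >= n being replaced by the closed term 0. *)
Fixpoint dholds (e : seq U) (f : dformula C) : Prop :=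
  match f with
  | DEqual t1 t2 => deval e t1 = deval e t2
  | DNot f1 => ~ dholds e f1
  | DAnd f1 f2 => dholds e f1 /\ dholds e f2
  | DExists i f1 => exists x, dholds (set_nth 0 e i x) f1
  end.

End Semantics.

(* |A| < |U| *)
Definition small A : Prop := ~ ([set: U] #<= A)%card.

(* Every finitely satisfiable set of formulas in n variables with parameters
   in a small set is realized. *)
Definition saturated : Prop :=
  forall A, small A -> forall (n : nat) (p : set (dformula A)),
  (forall q : set (dformula A), q `<=` p -> finite_set q ->
     exists t : n.-tuple U, forall f, q f -> dholds set_val t f) ->
  exists t : n.-tuple U, forall f, p f -> dholds set_val t f.

(* A differential polynomial of order at most n in one indeterminate X is a
   polynomial in X, X', ..., X^(n), i.e. an element of {mpoly U[n.+1]}, to be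
   evaluated at the jet of a; it has order exactly n when X^(n) occurs in it,
   and the elements of {mpoly U[n]} are those of order < n. *)
Definition jet n a : 'I_n -> U := fun i => iter i delta a.

(* Blum's axioms. The case n = 0 says that U is algebraically closed. *)
Definition blum : Prop :=
  forall (n : nat) (f : {mpoly U[n.+1]}) (g : {mpoly U[n]}),
  (exists2 m, m \in msupp f & m ord_max != 0%N) -> g != 0 ->
  exists a, f.@[@jet n.+1 a] = 0 /\ g.@[@jet n a] != 0.

Definition DCF0_model : Prop :=
  [/\ [pchar U] =i pred0, leibniz & blum].

Definition constants : set U := [set x | delta x = 0].

Definition subfield_set F : Prop := GRing.divring_closed (mem F).

Definition dsubfield_set F : Prop :=
  subfield_set F /\ forall x, F x -> F (delta x).

Definition gen_field S : set U := smallest subfield_set S.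

Definition gen_dfield S : set U := smallest dsubfield_set S.

Definition coefs P : set U := range (fun i : nat => P`_i).

Definition alg_closure F : set U :=
  [set x | exists p : {poly U}, [/\ p \is a polyOver (mem F), p != 0 & root p x]].

(* "Generic and independent from the coefficients of P" *)
Definition generic_over P c : Prop := ~ alg_closure (gen_field (coefs P)) c.

(* Nonorthogonality to the constants of the equation z' = P(z) + c *)
Definition nonorthogonal_to_constants P c : Prop :=
  exists F, [/\ dsubfield_set F, gen_field (c |` coefs P) `<=` F, small F &
    exists a, delta a = P.[a] + c /\
      exists k, [/\ gen_dfield (F `|` [set a]) k, constants k &
                    ~ alg_closure F k]].

Definition orthogonal_to_constants P c : Prop :=
  ~ nonorthogonal_to_constants P c.

End Differential.

(* Main.v *)
From HB Require Import structures.
Require Import Defs.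
From mathcomp Require Import all_boot all_order all_algebra.
From mathcomp Require Import mpoly.
From mathcomp Require Import mathcomp_extra boolp classical_sets.
From mathcomp Require Import ring.

Set Implicit Arguments.
Unset Strict Implicit.
Unset Printing Implicit Defensive.

Import GRing.Theory.

Local Open Scope classical_set_scope.
Local Open Scope ring_scope.

(** Put Q = P + c and suppose that a solution a of z' = Q(z) yields a constant
    k in F(a) that is not algebraic over F.  Then a is transcendental over F
    and k = f(a)/g(a) for polynomials f, g, so the nonconstant rational
    function f/g is killed by the derivation D of U(X) that extends delta with
    D X = Q: it is a first integral of the equation
    ([first_integral_of_new_constant]).  From here on F is forgotten and
    everything takes place over U, with constant field C.

    A root a of Q is a constant, and X - a divides D(X - a), so D can be read
    off from the expansion of f/g in powers of t = X - a; if a is a pole, pass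
    to the inverse, which is also a first integral.  Let lam = Q'(a) <> 0.
    - The first nonzero coefficient v of positive degree n in the expansion
      satisfies v' = - n lam v ([first_integral_exponential]); an n-th root y of it
      satisfies y' = - lam y.
    - The equation D(f/g) = 0 is a triangular linear system for the
      coefficients, and solving it degree by degree shows that all of them are
      polynomials in y with constant coefficients ([invariant_series_coef]).
    - A rational function whose Taylor coefficients lie in a subfield is a
      rational function over that subfield ([rational_reconstruction]).  Hence
      f/g can be written with coefficients in C(y) ([first_integral_descent]).

    Now expand the same function, or its inverse, at another root b: the first
    nonzero coefficient of positive degree n is an element v of C(y) with
    v' = - n Q'(b) v.  As y is
    transcendental over C, the logarithmic derivative of v in C(y) forces
    n Q'(b) to be an integer multiple of Q'(a)
    ([exponential_fraction], [first_integral_multipliers]).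

    For a cubic Q with roots a, b, e, a rational ratio between
    Q'(a) = l (a - b) (a - e) and Q'(b) = l (b - a) (b - e) is a rational linear
    relation between the differences of the roots.  Together with the two
    symmetric functions a + b + e and ab + ae + be, which do not involve the
    constant term of Q, it makes a algebraic over the coefficients of P
    ([cubic_root_algebraic]).  Then so is c = - P(a), against genericity.  The
    same argument excludes multiple roots of Q. *)

(** * Subfields, their fractions and their algebraic elements *)

(** Bundling a subfield given as a set makes the closure lemmas for
    polynomials over it available. *)
Definition subfield_pred (U : fieldType) (F : set U) (hF : subfield_set F) :
    divringClosed U :=
  HB.pack (mem F : {pred U}) (GRing.isDivringClosed.Build U (mem F) hF).

Lemma subfield_predE (U : fieldType) (F : set U) (hF : subfield_set F) x :
  (x \in subfield_pred hF) <-> F x.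
Proof. by rewrite -[x \in _]/(x \in F) inE. Qed.

Lemma gen_field_subfield (U : fieldType) (S : set U) : subfield_set (gen_field S).
Proof.
split=> [|x y|x y]; rewrite !inE /gen_field /smallest /bigcap /=.
- by move=> A [[A1 _ _] _]; rewrite -in_setE.
- move=> hx hy A AS; have [[_ AB _] _] := AS.
  by rewrite -in_setE; apply: AB; rewrite inE; [apply: hx|apply: hy].
- move=> hx hy A AS; have [[_ _ AV] _] := AS.
  by rewrite -in_setE; apply: AV; rewrite inE; [apply: hx|apply: hy].
Qed.

Section SubfieldType.
Variables (U : fieldType) (E : divringClosed U).

(** Linear algebra and algebraicity over a subfield need it as a type. *)
Definition subfield_type := {x : U | x \in E}.
HB.instance Definition _ := SubChoice.on subfield_type.
HB.instance Definition _ := [SubChoice_isSubIntegralDomain of subfield_type by <:].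
HB.instance Definition _ := [SubIntegralDomain_isSubField of subfield_type by <:].

Definition inclusion : {rmorphism subfield_type -> U} := val.

Lemma map_inclusion_over (p : {poly subfield_type}) :
  map_poly inclusion p \is a polyOver E.
Proof. by apply/polyOverP=> i; rewrite coef_map; apply: valP. Qed.

Lemma polyOver_map_inclusion (p : {poly U}) : p \is a polyOver E ->
  exists q : {poly subfield_type}, p = map_poly inclusion q.
Proof.
move=> /polyOverP h; exists (\poly_(i < size p) (Sub p`_i (h i) : subfield_type)).
apply/polyP=> i; rewrite coef_map coef_poly.
by case: ltnP => [_|si] //=; rewrite nth_default.
Qed.

(** With polynomials of size at most N on both sides, the congruence
    f1 = g1 k modulo X^(2N-1) is a linear system over E with 2N unknowns and
    2N - 1 equations, so it has a nonzero solution over E.  Any two solutions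
    define the same fraction, because f1 g - f g1 is divisible by X^(2N-1) and
    has smaller degree. *)
Lemma rational_reconstruction (f g k : {poly U}) N :
  (size f <= N)%N -> (size g <= N)%N -> g != 0 -> k \is a polyOver E ->
  'X^((N + N).-1) %| f - g * k ->
  exists f1 g1, [/\ f1 \is a polyOver E, g1 \is a polyOver E,
    g1 != 0 & f1 * g = f * g1].
Proof.
move=> sf sg g0 /polyOver_map_inclusion[k0 ek] /dvdpP[r er].
set M := (N + N).-1 in er *.
have N0 : (0 < N)%N by apply: leq_trans sg; rewrite size_poly_gt0.
pose A : 'M[subfield_type]_(N + N, M) := col_mx
  (\matrix_(i < N, j < M) ('X^i)`_j) (\matrix_(i < N, j < M) - ('X^i * k0)`_j).
have /rowV0Pn[v vA v0] : kermx A != 0.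
  rewrite -mxrank_eq0 mxrank_ker -lt0n subn_gt0.
  by rewrite (leq_ltn_trans (rank_leq_col A)) // /M prednK // addn_gt0 N0.
move/sub_kermxP: vA; rewrite -[v]hsubmxK mul_row_col => vA.
set a := lsubmx v in vA; set b := rsubmx v in vA.
pose f1 := rVpoly a; pose g1 := rVpoly b.
have cong j : (j < M)%N -> (f1 - g1 * k0)`_j = 0.
  move=> jM; have := congr1 (fun B : 'rV_M => B 0 (Ordinal jM)) vA; rewrite !mxE => eA.
  rewrite -[RHS]eA coefB /f1 /g1 /rVpoly.
  rewrite !poly_def mulr_suml !coef_sum -sumrN; congr (_ + _); apply: eq_bigr => i _.
    by rewrite valK coefZ; congr (_ * _); rewrite mxE.
  by rewrite valK -scalerAl coefZ -mulrN; congr (_ * _); rewrite mxE.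
have nz : (f1 != 0) || (g1 != 0).
  apply: contraNT v0; rewrite negb_or !negbK => /andP[/eqP f10 /eqP g10].
  by rewrite -[v]hsubmxK -/a -/b -[a]rVpolyK -[b]rVpolyK -/f1 -/g1 f10 g10 !linear0 row_mx0.
have sf1 : (size (map_poly inclusion f1) <= N)%N.
  by rewrite size_map_poly; apply: size_poly.
have sg1 : (size (map_poly inclusion g1) <= N)%N.
  by rewrite size_map_poly; apply: size_poly.
have sM (p q : {poly U}) : (size p <= N)%N -> (size q <= N)%N -> (size (p * q)%R <= M)%N.
  move=> sp sq; apply: leq_trans (size_polyMleq _ _) _.
  by rewrite /M -!subn1 leq_sub2r // leq_add.
have e : map_poly inclusion f1 * g = f * map_poly inclusion g1.
  apply/polyP => j; have [jM|Mj] := ltnP j M; last first.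
    by rewrite !nth_default // (leq_trans _ Mj) // sM.
  apply/eqP; rewrite -subr_eq0 -coefB.
  have -> : map_poly inclusion f1 * g - f * map_poly inclusion g1 =
     map_poly inclusion (f1 - g1 * k0) * g - (map_poly inclusion g1 * r) * 'X^M.
    rewrite -mulrA -er rmorphB rmorphM /= -ek.
    move: (map_poly _ f1) (map_poly _ g1) => F1 G1; ring.
  rewrite coefB coefMXn jM subr0 coefM big1 // => i _.
  by rewrite coef_map cong ?raddf0 ?mul0r // (leq_ltn_trans _ jM) // -ltnS.
exists (map_poly inclusion f1), (map_poly inclusion g1); split=> //;
  try exact: map_inclusion_over.
rewrite map_poly_eq0; apply: contraTneq nz => g10; rewrite g10 eqxx orbF negbK.
rewrite -(map_poly_eq0 inclusion); move/eqP: e.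
by rewrite g10 map_poly0 mulr0 mulf_eq0 (negPf g0) orbF.
Qed.

Definition fractions y : set U :=
  [set x | exists f g, [/\ f \is a polyOver E, g \is a polyOver E,
    g.[y] != 0 & x = f.[y] / g.[y]]].

Lemma fractions_subfield y : subfield_set (fractions y).
Proof.
split=> [|u v|u v]; rewrite !inE /fractions /=.
- by exists 1, 1; rewrite rpred1 hornerC oner_neq0 divr1.
- move=> [f [g [fE gE g0 ->]]] [f1 [g1 [f1E g1E g10 ->]]].
  exists (f * g1 - f1 * g), (g * g1); rewrite rpredB ?rpredM // !hornerE mulf_neq0 //.
  by split=> //; field; rewrite g0 g10.
- move=> [f [g [fE gE g0 ->]]] [f1 [g1 [f1E g1E g10 ->]]].
  have [f10|f10] := eqVneq f1.[y] 0.
    by exists 0, 1; rewrite rpred0 rpred1 !hornerE oner_neq0 f10 ?(mul0r, invr0, mulr0).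
  exists (f * g1), (g * f1); rewrite !rpredM // !hornerE mulf_neq0 //; split=> //.
  by field; rewrite f10 g0 g10.
Qed.

Lemma fractions_horner y f : f \is a polyOver E -> fractions y f.[y].
Proof. by exists f, 1; rewrite rpred1 hornerC oner_neq0 divr1. Qed.

Lemma fractions_base y x : x \in E -> fractions y x.
Proof.
by move=> xE; rewrite -[x](hornerC x y); apply: fractions_horner; rewrite polyOverC.
Qed.

Lemma fractions_gen y : fractions y y.
Proof.
rewrite -[X in fractions _ X](hornerX y).
by apply: fractions_horner; rewrite polyOverX.
Qed.

Lemma algebraicOverP x : algebraicOver inclusion x <->
  exists p : {poly U}, [/\ p \is a polyOver E, p != 0 & root p x].
Proof.
split=> [[q q0 rq]|[p [/polyOver_map_inclusion[q ->] q0 rp]]].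
  by exists (map_poly inclusion q); rewrite map_poly_eq0 map_inclusion_over.
by exists q; rewrite // -(map_poly_eq0 inclusion).
Qed.

Lemma algebraic_base x : x \in E -> algebraicOver inclusion x.
Proof. by move=> xE; exact: (algebraic_id inclusion (Sub x xE)). Qed.

Lemma algebraic_horner f x : f \is a polyOver E ->
  algebraicOver inclusion x -> algebraicOver inclusion f.[x].
Proof.
move=> /polyOver_map_inclusion[q ->] /integral_algebraic xE.
apply/integral_algebraic/integral_horner => //.
by apply/integral_poly=> i; rewrite coef_map; apply: integral_id.
Qed.

Lemma algebraic_fractions y x : algebraicOver inclusion y -> fractions y x ->
  algebraicOver inclusion x.
Proof.
by move=> yE [f [g [fE gE _ ->]]]; apply: algebraic_div; apply: algebraic_horner.
Qed.

End SubfieldType.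

(** * The derivation of U(X) defined by a differential equation *)

Section Derivation.
Variables (U : fieldType) (delta : {additive U -> U}).
Hypothesis delta_leibniz : leibniz delta.
Implicit Types (f g k p Q : {poly U}) (E : divringClosed U).

Lemma delta1 : delta 1 = 0.
Proof.
have := delta_leibniz 1 1; rewrite !mulr1 mul1r => /eqP.
by rewrite -subr_eq0 opprD addNKr oppr_eq0 => /eqP.
Qed.

Lemma deltaV x : delta x^-1 = - delta x / x ^+ 2.
Proof.
have [->|x0] := eqVneq x 0; first by rewrite invr0 raddf0 oppr0 mul0r.
have := delta_leibniz x x^-1; rewrite divff // delta1 => /esym h.
apply: (mulfI x0); move/eqP: h; rewrite addrC addr_eq0 => /eqP ->.
by field.
Qed.

Lemma delta_exp x n : delta (x ^+ n) = x ^+ n.-1 * delta x *+ n.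
Proof.
elim: n => [|n IH]; first by rewrite expr0 delta1 mulr0n.
rewrite exprS delta_leibniz {}IH; case: n => [|n] /=.
  by rewrite !expr0 mulr0n mulr0 addr0 mulr1 mul1r.
by rewrite exprS mulrnAr; ring.
Qed.

Lemma delta_div_const x y : y != 0 ->
  (delta (x / y) == 0) = (delta x * y == x * delta y).
Proof.
move=> y0; rewrite delta_leibniz deltaV -subr_eq0 -[RHS]subr_eq0.
have -> : delta x / y + x * (- delta y / y ^+ 2) - 0
  = (delta x * y - x * delta y) / y ^+ 2 by field.
by rewrite mulf_eq0 invr_eq0 expf_eq0 /= (negPf y0) orbF.
Qed.

Lemma constants_divring_closed : subfield_set (constants delta).
Proof.
split=> [|x y|x y]; rewrite ?inE /constants /=.
- exact: delta1.
- by move=> dx dy; rewrite raddfB dx dy subr0.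
- by move=> dx dy; rewrite delta_leibniz deltaV dx dy !mul0r oppr0 !(mul0r, mulr0) addr0.
Qed.

Definition coef_der p := map_poly delta p.

Lemma coef_derM f g : coef_der (f * g) = coef_der f * g + f * coef_der g.
Proof.
apply/polyP=> i; rewrite coef_map coefD !coefM raddf_sum -big_split /=.
by apply: eq_bigr => j _; rewrite delta_leibniz !coef_map.
Qed.

Lemma coef_derD f g : coef_der (f + g) = coef_der f + coef_der g.
Proof. exact: raddfD. Qed.

Lemma coef_derC c : coef_der c%:P = (delta c)%:P.
Proof. by rewrite /coef_der map_polyC. Qed.

Lemma coef_derX : coef_der 'X = 0.
Proof.
apply/polyP=> i; rewrite coef_map coefX coef0; case: eqP => _ /=.
  exact: delta1.
exact: raddf0.
Qed.

Lemma coef_der_const p : (forall i, delta p`_i = 0) -> coef_der p = 0.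
Proof.
by move=> h; apply/polyP=> i; rewrite coef_map coef0; apply: h.
Qed.

Lemma delta_horner f a : delta f.[a] = (coef_der f).[a] + f^`().[a] * delta a.
Proof.
elim/poly_ind: f => [|f b IH].
  by rewrite /coef_der map_poly0 deriv0 !horner0 raddf0 mul0r addr0.
rewrite coef_derD coef_derM coef_derX coef_derC derivD derivM derivX derivC !hornerE.
by rewrite raddfD /= delta_leibniz IH; ring.
Qed.

Lemma coef_der_shift f a : delta a = 0 ->
  coef_der (f \Po ('X + a%:P)) = coef_der f \Po ('X + a%:P).
Proof.
move=> da; elim/poly_ind: f => [|f b IH].
  by rewrite /coef_der comp_poly0 map_poly0 comp_poly0.
rewrite coef_derD coef_derM coef_derX coef_derC.
rewrite !comp_polyD !comp_polyM !comp_polyX !comp_polyC coef_derD coef_derM IH.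
by rewrite coef_derD coef_derX !coef_derC da ?comp_poly0 ?addr0 !mulr0 ?addr0.
Qed.

(** The derivation of U[X] that extends delta and maps X to Q: the total
    derivative along the equation z' = Q(z). *)
Definition flow_der Q f := coef_der f + Q * f^`().

Lemma flow_derM Q f g : flow_der Q (f * g) = flow_der Q f * g + f * flow_der Q g.
Proof. by rewrite /flow_der coef_derM derivM; ring. Qed.

Lemma flow_derD Q f g : flow_der Q (f + g) = flow_der Q f + flow_der Q g.
Proof. by rewrite /flow_der coef_derD derivD; ring. Qed.

Lemma flow_derC Q c : flow_der Q c%:P = (delta c)%:P.
Proof. by rewrite /flow_der coef_derC derivC mulr0 addr0. Qed.

Lemma flow_derXn Q n : flow_der ('X * Q) ('X^n) = 'X^n * Q *+ n.
Proof.
have -> : flow_der ('X * Q) ('X^n) = 'X * Q * ('X^n)^`().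
  rewrite /flow_der; suff -> : coef_der 'X^n = 0 by rewrite add0r.
  apply: coef_der_const => i; rewrite coefXn.
  by case: eqP => _; rewrite ?delta1 ?raddf0.
rewrite derivXn; case: n => [|n]; first by rewrite !mulr0n mulr0.
by rewrite mulrnAr /= exprS; congr (_ *+ _); ring.
Qed.

(** This is what the derivation is made for: evaluating at a solution of
    z' = Q(z) turns it into delta. *)
Lemma flow_der_horner Q f a : delta a = Q.[a] -> (flow_der Q f).[a] = delta f.[a].
Proof. by move=> da; rewrite delta_horner da /flow_der !hornerE; ring. Qed.

Lemma flow_der_shift Q f a : delta a = 0 ->
  flow_der (Q \Po ('X + a%:P)) (f \Po ('X + a%:P)) = flow_der Q f \Po ('X + a%:P).
Proof.
move=> da; rewrite /flow_der coef_der_shift // deriv_comp derivD derivX derivC addr0 mulr1.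
by rewrite comp_polyD comp_polyM.
Qed.

(** Up to the factor g^2, the image of f / g under the derivation. *)
Definition wronskian Q f g := flow_der Q f * g - f * flow_der Q g.

Lemma wronskianMl Q u f g : wronskian Q (u * f) (u * g) = u ^+ 2 * wronskian Q f g.
Proof. by rewrite /wronskian !flow_derM; ring. Qed.

(** A rational function f / g outside U that the derivation kills. *)
Definition first_integral Q f g :=
  [/\ g != 0, forall c, f <> c *: g & wronskian Q f g = 0].

Lemma first_integralC Q f g : first_integral Q f g -> first_integral Q g f.
Proof.
move=> [g0 nfg w0]; split; first by apply/eqP=> f0; apply: (nfg 0); rewrite scale0r.
  move=> c gf; have c0 : c != 0 by apply: contraNneq g0 => c0; rewrite gf c0 scale0r.
  by apply: (nfg c^-1); rewrite gf scalerA mulVf // scale1r.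
by rewrite -[LHS]opprK; apply/eqP; rewrite oppr_eq0 -w0 /wronskian; apply/eqP; ring.
Qed.

Lemma first_integral_cancel Q u f g : u != 0 ->
  first_integral Q (u * f) (u * g) <-> first_integral Q f g.
Proof.
move=> u0; rewrite /first_integral wronskianMl mulf_eq0 negb_or u0 /=; split.
  move=> [g0 nfg /eqP]; rewrite mulf_eq0 expf_eq0 /= (negPf u0) /= => /eqP w0.
  by split=> // c fg; apply: (nfg c); rewrite fg -scalerAr.
move=> [g0 nfg ->]; rewrite mulr0; split=> // c; rewrite scalerAr => /(mulfI u0).
exact: nfg.
Qed.

Lemma wronskian_cross Q f g f1 g1 : g != 0 -> wronskian Q f g = 0 ->
  f1 * g = f * g1 -> wronskian Q f1 g1 = 0.
Proof.
move=> g0 w0 e; suff: g ^+ 2 * wronskian Q f1 g1 = 0.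
  by move/eqP; rewrite mulf_eq0 expf_eq0 /= (negPf g0) => /eqP.
have -> : g ^+ 2 * wronskian Q f1 g1 = g1 ^+ 2 * wronskian Q f g
   + (flow_der Q (f1 * g) - flow_der Q (f * g1)) * g * g1
   - (f1 * g - f * g1) * (flow_der Q (g * g1)).
  by rewrite /wronskian !flow_derM; ring.
by rewrite w0 e !subrr; ring.
Qed.

Lemma first_integral_cross Q f g f1 g1 : g1 != 0 ->
  first_integral Q f g -> f1 * g = f * g1 -> first_integral Q f1 g1.
Proof.
move=> g10 [g0 nfg w0] e; split=> // [c fc|]; last exact: wronskian_cross w0 e.
apply: (nfg c); apply: (mulIf g10); rewrite -e fc -!scalerAl; congr (_ *: _); ring.
Qed.

(** A constant translation of the variable is a change of coordinates for the
    equation, so that expansions need only be studied at a zero of Q in 0. *)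
Lemma first_integral_shift Q f g a : delta a = 0 -> first_integral Q f g ->
  first_integral (Q \Po ('X + a%:P)) (f \Po ('X + a%:P)) (g \Po ('X + a%:P)).
Proof.
have K p : (p \Po ('X + a%:P)) \Po ('X - a%:P) = p.
  by rewrite -comp_polyA comp_polyD comp_polyX comp_polyC subrK comp_polyXr.
move=> da [g0 nfg w0]; split.
- by apply: contraNneq g0 => gs; rewrite -[g]K gs comp_poly0.
- by move=> c fs; apply: (nfg c); rewrite -[f]K fs comp_polyZ K.
- rewrite /wronskian !flow_der_shift // -!comp_polyM -comp_polyB.
  by rewrite -/(wronskian Q f g) w0 comp_poly0.
Qed.

Lemma polyOver_mulXn E f n : f * 'X^n \is a polyOver E -> f \is a polyOver E.
Proof.
move=> /polyOverP h; apply/polyOverP=> i; have := h (i + n)%N.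
by rewrite coefMXn ltnNge leq_addl /= addnK.
Qed.

Lemma ex_mulXn f : f != 0 -> exists n f1, f1.[0] != 0 /\ f = f1 * 'X^n.
Proof.
move=> f0; have [n [f1]] := multiplicity_XsubC f 0.
rewrite f0 /= subr0 => h e; exists n, f1; split=> //.
Qed.

Lemma horner0_mulX Q : Q.[0] = 0 -> exists Q1, Q = 'X * Q1.
Proof.
move=> Q0; have /factor_theorem[Q1 ->] : root Q 0 by rewrite rootE Q0.
by exists Q1; rewrite subr0 mulrC.
Qed.

(** Common powers of X cancel, and the inverse of a first integral with a pole
    at 0 is a first integral that vanishes there. *)
Lemma first_integral_normalize E Q f g :
  f \is a polyOver E -> g \is a polyOver E -> first_integral Q f g ->
  exists f1 g1, [/\ f1 \is a polyOver E, g1 \is a polyOver E,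
    g1.[0] != 0 & first_integral Q f1 g1].
Proof.
move=> fE gE fg.
have [g0 _ _] := fg; have [f0 _ _] := first_integralC fg.
have [i [f1 [f10 ef]]] := ex_mulXn f0; have [j [g1 [g10 eg]]] := ex_mulXn g0.
have Xn0 n : 'X^n != 0 :> {poly U} by rewrite monic_neq0 ?monicXn.
have [f1E g1E] : f1 \is a polyOver E /\ g1 \is a polyOver E.
  by split; [apply: (@polyOver_mulXn _ _ i); rewrite -ef
            |apply: (@polyOver_mulXn _ _ j); rewrite -eg].
have [ji|/ltnW ij] := leqP j i.
  exists (f1 * 'X^(i - j)), g1; split=> //; first by rewrite rpredM ?polyOverXn.
  apply/(first_integral_cancel Q _ _ (Xn0 j)).
  by rewrite mulrC -mulrA -exprD subnK // -ef mulrC -eg.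
exists (g1 * 'X^(j - i)), f1; split=> //; first by rewrite rpredM ?polyOverXn.
apply/(first_integral_cancel Q _ _ (Xn0 i)).
by rewrite mulrC -mulrA -exprD subnK // -eg mulrC -ef; apply: first_integralC.
Qed.

(** The value of f / g at the fixed point 0 is a constant; once it is subtracted,
    the function is t^(n+1) times a unit, and the derivation multiplies
    t^(n+1) by (n+1) Q / t, which takes the value (n+1) Q'(0) at 0.  So
    the leading coefficient v of the expansion satisfies the equation of an
    exponential. *)
Lemma first_integral_exponential E Q f g : Q.[0] = 0 ->
  f \is a polyOver E -> g \is a polyOver E -> first_integral Q f g ->
  exists v n, [/\ v \in E, v != 0 & delta v = - (Q`_1 *+ n.+1) * v].
Proof.
move=> Q0 fE0 gE0 /(first_integral_normalize fE0 gE0)[{fE0 gE0}f1 [{}g [fE gE g0 fg]]].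
have ev p : (flow_der Q p).[0] = delta p.[0] by rewrite flow_der_horner // Q0 raddf0.
have [_ nfg w0] := fg.
have gE0 : g.[0] \in E by rewrite rpred_horner ?rpred0.
pose c := f1.[0] / g.[0].
have dc : delta c = 0.
  apply/eqP; rewrite delta_div_const // -subr_eq0 -!ev.
  by have := congr1 (horner^~ 0) w0; rewrite /wronskian !hornerE => ->.
pose f2 := f1 - c%:P * g.
have f2E : f2 \is a polyOver E.
  by rewrite rpredB // rpredM // polyOverC rpred_div // rpred_horner ?rpred0.
have f20 : f2 != 0 by rewrite subr_eq0; apply/eqP; rewrite mul_polyC; exact: nfg.
have w2 : wronskian Q f2 g = 0.
  have -> : wronskian Q f2 g = wronskian Q f1 g - (flow_der Q c%:P) * g * g.
    rewrite /wronskian /f2.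
    have -> : flow_der Q (f1 - c%:P * g) = flow_der Q f1 - flow_der Q (c%:P * g).
      by apply/eqP; rewrite eq_sym subr_eq -flow_derD subrK.
    rewrite flow_derM; ring.
  by rewrite w0 flow_derC dc !mul0r subr0.
have [n [h [h0 eh]]] := ex_mulXn f20.
have hE : h \is a polyOver E by apply: (@polyOver_mulXn _ _ n); rewrite -eh.
have [Q1 eQ] := horner0_mulX Q0.
have eQ1 : Q1.[0] = Q`_1 by rewrite eQ coefXM /= horner_coef0.
have key : delta h.[0] * g.[0] - h.[0] * delta g.[0] + (Q`_1 *+ n) * h.[0] * g.[0] = 0.
  have : 'X^n * (wronskian Q h g + (Q1 *+ n) * h * g) = 0.
    have dX : flow_der Q 'X^n = 'X^n * (Q1 *+ n).
      by rewrite {1}eQ flow_derXn -mulrnAr.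
    rewrite -w2 eh /wronskian flow_derM dX; ring.
  move/eqP; rewrite mulf_eq0 expf_eq0 polyX_eq0 andbF /= => /eqP /(congr1 (horner^~ 0)).
  by rewrite /wronskian !(ev, hornerD, hornerN, hornerM, hornerMn) eQ1 horner0.
(* f2 vanishes at 0, so its order there is positive. *)
case: n => [|n] in eh key *.
  have : f2.[0] = 0 by rewrite /f2 !hornerE /c; field.
  by rewrite eh expr0 mulr1 => /eqP; rewrite (negPf h0).
exists (h.[0] / g.[0]), n; split.
- by rewrite rpred_div // rpred_horner ?rpred0.
- by rewrite mulf_neq0 ?invr_eq0.
- rewrite delta_leibniz deltaV; move/eqP: key; rewrite addr_eq0 subr_eq => /eqP key.
  have -> : delta h.[0] = (- (Q`_1 *+ n.+1 * h.[0] * g.[0]) + h.[0] * delta g.[0]) / g.[0].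
    by rewrite -key; field.
  by field.
Qed.
End Derivation.

(** * Expansions at a fixed point *)

Section Expansion.
Variables (U : fieldType) (delta : {additive U -> U}).
Hypothesis delta_leibniz : leibniz delta.
Hypothesis pchar0 : [pchar U] =i pred0.
Implicit Types (f g k p Q : {poly U}).
Variables (C : divringClosed U) (C_constants : forall x, x \in C <-> delta x = 0).
Local Notation D := (flow_der delta).

Lemma natr_eq0_pchar0 n : (n%:R == 0 :> U) = (n == 0)%N.
Proof. exact: (pcharf0P U).1. Qed.

(** The polynomial k is the power series of f / g truncated at order M. *)
Lemma truncated_quotient f g M : g.[0] != 0 ->
  exists2 k : {poly U}, (size k <= M)%N & 'X^M %| f - g * k.
Proof.
move=> g0; have /Bezout_eq1_coprimepP[[u v] /= uv] : coprimep g 'X^M.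
  by rewrite coprimep_expr // coprimepX rootE.
exists ((u * f) %% 'X^M).
  by rewrite -ltnS -(size_polyXn U M) ltn_modp monic_neq0 ?monicXn.
have -> : f - g * ((u * f) %% 'X^M) = 'X^M * (v * f + g * ((u * f) %/ 'X^M)).
  have e := divp_eq (u * f) 'X^M.
  have -> : (u * f) %% 'X^M = u * f - (u * f) %/ 'X^M * 'X^M.
    by rewrite {2}e addrC addKr.
  move: uv; set q := _ %/ _; set X := 'X^M => uv.
  rewrite -[X in X - _ = _](mul1r f) -uv; ring.
exact: dvdp_mulr.
Qed.

(** As X divides Q, the derivation preserves the ideal generated by X^M, hence
    acts on truncated power series. *)
Lemma truncated_quotient_invariant Q f g k M :
  Q.[0] = 0 -> g.[0] != 0 -> wronskian delta Q f g = 0 -> 'X^M %| f - g * k ->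
  'X^M %| D Q k.
Proof.
move=> Q0 g0 w0 /dvdpP[r er].
have [Q1 eQ] := horner0_mulX Q0.
have ef : f = r * 'X^M + g * k by rewrite -er subrK.
have cop : coprimep 'X^M (g * g).
  by rewrite coprimep_sym coprimep_expr // coprimepMl !coprimepX rootE g0.
rewrite -(Gauss_dvdpr _ cop).
have dX : D Q 'X^M = 'X^M * (Q1 *+ M) by rewrite eQ flow_derXn // -mulrnAr.
have -> : g * g * D Q k = 'X^M * (r * D Q g - D Q r * g - r * (Q1 *+ M) * g).
  apply/eqP; rewrite -subr_eq0 -w0 ef /wronskian flow_derD !flow_derM // dX.
  apply/eqP; ring.
exact: dvdp_mulr.
Qed.

(** The coefficient of degree j satisfies k_j' + j lam k_j + R(y) = 0 where
    lam = Q'(0) and R has degree less than j by induction.  As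
    (y^i)' = - i lam y^i, dividing the i-th coefficient of R by (j - i) lam
    gives, up to sign, a particular solution, and the solutions of the
    homogeneous equation are the constant multiples of y^j. *)
Lemma invariant_series_coef Q k (y : U) M : Q.[0] = 0 -> Q \is a polyOver C -> Q`_1 != 0 ->
  y != 0 -> delta y = - Q`_1 * y -> 'X^M %| D Q k ->
  forall j, (j < M)%N -> exists q : {poly U},
    [/\ q \is a polyOver C, (size q <= j.+1)%N & k`_j = q.[y]].
Proof.
move=> Q0 QC Q10 y0 dy /dvdpP[r er]; elim/ltn_ind => j IH jM.
have [Q1 eQ] := horner0_mulX Q0.
have eQ1 i : Q1`_i = Q`_i.+1 by rewrite eQ coefXM.
have [R [RC sR eqn]] : exists R : {poly U}, [/\ R \is a polyOver C, (size R <= j)%N &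
     delta k`_j + Q`_1 * k`_j *+ j + R.[y] = 0].
  have := congr1 (fun p : {poly U} => p`_j) er.
  rewrite coefMXn jM coefD coef_map /= {1}eQ -mulrA coefXM => e0.
  case: j => [|j] in IH jM e0 *.
    by exists 0; rewrite rpred0 size_poly0 horner0 mulr0n !addr0; rewrite /= addr0 in e0.
  have [R [RC sR eR]] : exists R : {poly U}, [/\ R \is a polyOver C, (size R <= j.+1)%N &
     \sum_(i < j) Q1`_i.+1 * k^`()`_(j - i.+1) = R.[y]].
    apply: (big_ind (fun s => exists R : {poly U},
      [/\ R \is a polyOver C, (size R <= j.+1)%N & s = R.[y]])).
    - by exists 0; rewrite rpred0 size_poly0 horner0.
    - move=> _ _ [p [pC sp ->]] [q [qC sq ->]]; exists (p + q); rewrite rpredD ?hornerD //.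
      by rewrite (leq_trans (size_polyD _ _)) // geq_max sp sq.
    - move=> i _; have [||q [qC sq kq]] := IH (j - i.+1).+1.
      + by rewrite ltnS subnSK // leq_subr.
      + by rewrite (leq_ltn_trans _ jM) // subnSK // (leq_trans (leq_subr _ _)).
      exists ((Q1`_i.+1 *+ (j - i.+1).+1) *: q); split.
      * by rewrite polyOverZ // rpredMn // eQ1; apply/polyOverP.
      * rewrite (leq_trans (size_scale_leq _ _)) // (leq_trans sq) //.
        by rewrite ltnS subnSK // leq_subr.
      * by rewrite hornerZ coef_deriv kq mulrnAr mulrnAl.
  exists R; split=> //; rewrite -[RHS]e0 -eR -addrA; congr (_ + _).
  by rewrite /= coefM big_ord_recl /= subn0 coef_deriv eQ1 mulrnAr.
pose s := \poly_(i < j) (R`_i / (Q`_1 *+ (j - i))).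
have sC : s \is a polyOver C.
  apply/polyOverP => i; rewrite coef_poly; case: ifP => _; last exact: rpred0.
  by rewrite rpred_div ?rpredMn //; apply/polyOverP.
have sc i : delta s`_i = 0 by apply/C_constants/polyOverP.
have es : delta s.[y] + Q`_1 * s.[y] *+ j = R.[y].
  rewrite delta_horner // (coef_der_const sc) horner0 add0r.
  have -> : R.[y] = \sum_(i < j) R`_i * y ^+ i by exact: (horner_coef_wide y sR).
  have ss : (size s <= j)%N by apply: size_poly.
  rewrite (horner_coef_wide _ ss).
  have -> : s^`().[y] * delta y = \sum_(i < j) - (Q`_1 *+ i) * s`_i * y ^+ i.
    rewrite dy.
    have -> : s^`().[y] * (- Q`_1 * y) = ('X * s^`()).[y] * - Q`_1.
      by rewrite hornerM hornerX; ring.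
    have sd : (size ('X * s^`())%R <= j)%N.
      rewrite mulrC; have [->|s0] := eqVneq s 0; first by rewrite deriv0 mul0r size_poly0.
      have [->|sd0] := eqVneq s^`() 0; first by rewrite mul0r size_poly0.
      by rewrite size_mulX // (leq_trans _ ss) // lt_size_deriv.
    rewrite (horner_coef_wide _ sd) mulr_suml; apply: eq_bigr => -[[|i] ij] _ /=.
      by rewrite coefXM mulr0n !mul0r oppr0 !mul0r.
    rewrite coefXM /= coef_deriv; ring.
  rewrite mulr_sumr -sumrMnl -big_split /=; apply: eq_bigr => i _.
  rewrite coef_poly ltn_ord -(mulr_natr Q`_1 i) -(mulr_natr Q`_1 (j - i)).
  rewrite natrB ?(ltnW (ltn_ord i)) //.
  rewrite -mulr_natr; field.
  by rewrite Q10 -natrB ?(ltnW (ltn_ord i)) // natr_eq0_pchar0 subn_eq0 -ltnNge ltn_ord.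
have hC : (k`_j + s.[y]) / y ^+ j \in C.
  apply/C_constants/eqP; rewrite delta_div_const ?expf_neq0 //.
  have -> : delta (y ^+ j) = - (Q`_1 *+ j) * y ^+ j.
    rewrite delta_exp // dy; case: (j) => [|i]; first by rewrite !mulr0n oppr0 mul0r.
    rewrite exprS /=; ring.
  have -> : delta (k`_j + s.[y]) = - (Q`_1 *+ j) * (k`_j + s.[y]).
    rewrite raddfD /=; move: eqn; rewrite -es => eqn.
    apply/eqP; rewrite -subr_eq0; apply/eqP; rewrite -[RHS]eqn; ring.
  by apply/eqP; ring.
exists (((k`_j + s.[y]) / y ^+ j) *: 'X^j - s); split.
- by rewrite rpredB // polyOverZ // polyOverXn.
- rewrite (leq_trans (size_polyD _ _)) // geq_max size_polyN.
  rewrite (leq_trans (size_poly _ _)) // andbT.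
  by rewrite (leq_trans (size_scale_leq _ _)) // size_polyXn.
- by rewrite hornerD hornerN hornerZ hornerXn divfK ?expf_neq0 // addrK.
Qed.
End Expansion.

(** * Exponentials and the comparison of two fixed points *)

Section Multipliers.
Variables (U : fieldType) (delta : {additive U -> U}).
Hypothesis delta_leibniz : leibniz delta.
Hypothesis pchar0 : [pchar U] =i pred0.
Hypothesis closedU : forall p : {poly U}, (1 < size p)%N -> exists x, root p x.
Variables (C : divringClosed U) (C_constants : forall x, x \in C <-> delta x = 0).
Implicit Types (f g k p Q : {poly U}) (y lam mu : U).

Lemma coef_der_over f : f \is a polyOver C -> coef_der delta f = 0.
Proof. by move=> /polyOverP fC; apply: coef_der_const => i; apply/C_constants. Qed.

Lemma delta_horner_over f y : f \is a polyOver C -> delta f.[y] = f^`().[y] * delta y.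
Proof. by move=> fC; rewrite delta_horner // coef_der_over // horner0 add0r. Qed.

(** Differentiating f(y) = 0 gives f'(y) = 0, so f' = 0 by induction on the
    degree, and f is a constant. *)
Lemma exponential_transcendental y lam f : lam != 0 -> y != 0 -> delta y = - lam * y ->
  f \is a polyOver C -> f.[y] = 0 -> f = 0.
Proof.
move=> l0 y0 dy; have [n] := ubnP (size f); elim: n f => // n IH f sf fC fy.
have f'y : f^`().[y] = 0.
  apply/eqP; have := delta_horner_over y fC; rewrite fy raddf0 dy => /esym/eqP.
  by rewrite !mulf_eq0 oppr_eq0 (negPf l0) (negPf y0) !orbF.
have [-> //|f0] := eqVneq f 0.
have f'0 : f^`() = 0.
  by apply: IH; rewrite ?polyOver_deriv // (leq_trans (lt_size_deriv f0)) // -ltnS.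
have : (size f <= 1)%N.
  apply/leq_sizeP => -[|j] // _; apply/eqP; have := congr1 (fun p : {poly U} => p`_j) f'0.
  rewrite coef_deriv coef0 -mulr_natr => /eqP.
  by rewrite mulf_eq0 (natr_eq0_pchar0 pchar0) orbF.
by move=> /size1_polyC ef; move: fy; rewrite ef hornerC => ->.
Qed.

(** Writing v = A(y) / B(y), the transcendence of y turns v' = - mu v into an
    identity T = 0 in C[X], where T is A B times
    mu - lam X (A'/A - B'/B).  At X = 0 the expression X A'/A takes
    the value of the order of vanishing of A, which gives the relation. *)
Lemma exponential_fraction y lam mu v : lam \in C -> mu \in C -> lam != 0 -> y != 0 ->
  delta y = - lam * y -> fractions C y v -> v != 0 -> delta v = - mu * v ->
  exists i j, lam *+ i = lam *+ j + mu.
Proof.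
move=> lC mC l0 y0 dy [A [B [AC BC By ->]]].
rewrite mulf_eq0 invr_eq0 negb_or By andbT => Ay dv.
have A0 : A != 0 by apply: contraNneq Ay => ->; rewrite horner0.
have B0 : B != 0 by apply: contraNneq By => ->; rewrite horner0.
pose T := - lam *: ('X * (A^`() * B - A * B^`())) + mu *: (A * B).
have T0 : T = 0.
  apply: (@exponential_transcendental y lam) => //.
    rewrite rpredD // polyOverZ ?rpredN //; last exact: rpredM.
    by rewrite rpredM ?polyOverX // rpredB // rpredM // polyOver_deriv.
  move: dv; rewrite delta_leibniz deltaV // !delta_horner_over // dy.
  move/eqP; rewrite -subr_eq0.
  have -> : A^`().[y] * (- lam * y) / B.[y] +
     A.[y] * (- (B^`().[y] * (- lam * y)) / B.[y] ^+ 2) -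
     - mu * (A.[y] / B.[y]) = T.[y] / B.[y] ^+ 2.
    by rewrite /T !(hornerD, hornerN, hornerM, hornerZ, hornerX); field.
  by rewrite mulf_eq0 invr_eq0 expf_eq0 (negPf By) andbF orbF => /eqP.
have [i [A1 [A10 eA]]] := ex_mulXn A0; have [j [B1 [B10 eB]]] := ex_mulXn B0.
exists i, j; apply/eqP; rewrite -subr_eq0 -oppr_eq0; apply/eqP.
have dX n : 'X * ('X^n)^`() = 'X^n *+ n :> {poly U}.
  rewrite derivXn; case: n => [|n]; first by rewrite !mulr0n mulr0.
  by rewrite mulrnAr -exprS.
have : 'X^(i + j) * ((- lam *+ i + lam *+ j + mu) *: (A1 * B1)
        - lam *: ('X * (A1^`() * B1 - A1 * B1^`()))) = 0.
  rewrite -[RHS]T0 /T eA eB !derivM exprD -!mul_polyC.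
  have -> : 'X * ((A1^`() * 'X^i + A1 * ('X^i)^`()) * (B1 * 'X^j) -
                  A1 * 'X^i * (B1^`() * 'X^j + B1 * ('X^j)^`()))
    = 'X^i * 'X^j * ('X * (A1^`() * B1 - A1 * B1^`())) +
      A1 * B1 * (('X * ('X^i)^`()) * 'X^j - 'X^i * ('X * ('X^j)^`())).
     by ring.
  rewrite !dX !polyCD !polyCMn polyCN; ring.
move/eqP; rewrite mulf_eq0 expf_eq0 polyX_eq0 andbF /= => /eqP /(congr1 (horner^~ 0)).
rewrite !(hornerD, hornerN, hornerM, hornerZ, hornerX) horner0 mul0r mulr0 subr0.
move/eqP; rewrite !mulf_eq0 (negPf A10) (negPf B10) !orbF.
by move=> /eqP <-; ring.
Qed.

Lemma ex_root_exp v n : exists y, y ^+ n.+1 = v.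
Proof.
have [|y] := @closedU ('X^(n.+1) - v%:P); first by rewrite size_XnsubC.
by rewrite rootE !hornerE subr_eq0 => /eqP; exists y.
Qed.

Lemma ex_exponential lam v n : v != 0 -> delta v = - (lam *+ n.+1) * v ->
  exists2 y, y != 0 & delta y = - lam * y.
Proof.
move=> v0 dv; have [y ey] := ex_root_exp v n.
have y0 : y != 0 by apply: contraNneq v0 => y0; rewrite -ey y0 expr0n.
exists y => //; move: dv; rewrite -ey delta_exp //= => dv.
have n0 : y ^+ n *+ n.+1 != 0.
  by rewrite -mulr_natr mulf_neq0 ?expf_neq0 // (natr_eq0_pchar0 pchar0).
by apply: (mulfI n0); rewrite mulrnAl dv exprS; ring.
Qed.

(** The first nonconstant Taylor coefficient provides y; then all Taylor
    coefficients lie in C(y), and so do the coefficients of a suitable numerator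
    and denominator. *)
Lemma first_integral_descent Q f g : Q \is a polyOver C -> Q.[0] = 0 -> Q`_1 != 0 ->
  first_integral delta Q f g ->
  exists y f1 g1, [/\ y != 0, delta y = - Q`_1 * y,
    f1 \is a polyOver (subfield_pred (fractions_subfield C y)),
    g1 \is a polyOver (subfield_pred (fractions_subfield C y)) &
    first_integral delta Q f1 g1].
Proof.
move=> QC Q0 Q1 fg0.
have allE : subfield_set (setT : set U) by split=> [|x z|x z]; rewrite !inE.
pose E := subfield_pred allE.
have overE p : p \is a polyOver E by apply/polyOverP => i; apply/subfield_predE.
have [f2 [g2 [_ _ {fg0}g0 fg]]] :=
  first_integral_normalize delta_leibniz (overE f) (overE g) fg0.
have [v [n [_ v0 dv]]] :=
  first_integral_exponential delta_leibniz Q0 (overE f2) (overE g2) fg.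
have [y y0 dy] := ex_exponential v0 dv.
(* One expansion up to twice the size of f and g determines their quotient. *)
pose N := maxn (size f2) (size g2).
have [k sk dk] := truncated_quotient f2 (N + N).-1 g0.
have [gn0 _ w0] := fg.
have cf := invariant_series_coef delta_leibniz pchar0 C_constants Q0 QC Q1 y0 dy
   (truncated_quotient_invariant delta_leibniz Q0 g0 w0 dk).
have kE : k \is a polyOver (subfield_pred (fractions_subfield C y)).
  apply/polyOverP => j; have [jM|Mj] := ltnP j (N + N).-1; last first.
    by rewrite nth_default ?rpred0 // (leq_trans sk).
  have [q [qC _ ->]] := cf j jM; apply/subfield_predE; exact: fractions_horner.
have [f1 [g1 [fE gE g10 e]]] :=
  rational_reconstruction (leq_maxl _ _) (leq_maxr _ _) gn0 kE dk.
by exists y, f1, g1; split=> //; apply: first_integral_cross fg e.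
Qed.

Lemma comp_shift0 Q a : (Q \Po ('X + a%:P)).[0] = Q.[a].
Proof. by rewrite horner_comp !hornerE. Qed.

Lemma comp_shift1 Q a : (Q \Po ('X + a%:P))`_1 = Q^`().[a].
Proof.
have -> p : p`_1 = p^`().[0] :> U by rewrite horner_coef0 coef_deriv.
by rewrite deriv_comp derivD derivX derivC addr0 mulr1 comp_shift0.
Qed.

Lemma comp_shift_over (E : divringClosed U) Q a :
  Q \is a polyOver E -> a \in E -> Q \Po ('X + a%:P) \is a polyOver E.
Proof. by move=> QE aE; rewrite polyOver_comp // rpredD ?polyOverX ?polyOverC. Qed.

(** A first integral makes the multipliers Q'(a) and Q'(b) of two fixed points
    commensurable: the function is defined over C(y) with y an exponential of
    rate - Q'(a), while its expansion at b produces an exponential of rate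
    - (n+1) Q'(b) in that same field. *)
Lemma first_integral_multipliers Q f g a b : Q \is a polyOver C ->
  a \in C -> b \in C -> root Q a -> root Q b -> Q^`().[a] != 0 ->
  first_integral delta Q f g ->
  exists i j n, Q^`().[a] *+ i = Q^`().[a] *+ j + Q^`().[b] *+ n.+1.
Proof.
move=> QC aC bC /rootP Qa /rootP Qb Q'a fg.
have da : delta a = 0 by apply/C_constants.
have dba : delta (b - a) = 0 by apply/C_constants/rpredB.
have [|||y [f1 [g1 [y0 dy fE gE fg1]]]] :=
  first_integral_descent _ _ _ (first_integral_shift delta_leibniz da fg).
- exact: comp_shift_over.
- by rewrite comp_shift0.
- by rewrite comp_shift1.
set E := subfield_pred _ in fE gE.
have baE : b - a \in E by apply/subfield_predE/fractions_base/rpredB.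
have := first_integral_shift delta_leibniz dba fg1.
rewrite -comp_polyA comp_polyD comp_polyX comp_polyC -addrA -polyCD subrK => fg2.
have [|v [n [/subfield_predE vE v0]]] := first_integral_exponential delta_leibniz _
  (comp_shift_over fE baE) (comp_shift_over gE baE) fg2; first by rewrite comp_shift0.
rewrite comp_shift1 => dv; rewrite comp_shift1 in dy.
have dC c : c \in C -> Q^`().[c] \in C by move=> cC; rewrite rpred_horner ?polyOver_deriv.
have [|i [j e]] := exponential_fraction (dC _ aC) _ Q'a y0 dy vE v0 dv.
  by rewrite rpredMn ?dC.
by exists i, j, n.
Qed.
End Multipliers.

(** * Roots of polynomials and cubics *)

(** For order zero, differential polynomials are ordinary polynomials in one
    variable and their jets are single points. *)
Lemma blum_root (U : fieldType) (delta : {additive U -> U}) : blum delta ->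
  forall p : {poly U}, (1 < size p)%N -> exists x, root p x.
Proof.
move=> bl p sp.
pose f : {mpoly U[1]} := \sum_(i < size p) p`_i *: 'X_ord0 ^+ i.
have fE m : f@_m = p`_(m ord0).
  rewrite /f raddf_sum /=.
  under eq_bigr => i _ do rewrite mcoeffZ mpolyXn mcoeffX.
  have eqm (i : nat) : ((U_(ord0) *+ i)%MM == m) = (i == m ord0).
    apply/eqP/eqP => [<-|->]; first by rewrite mulmnE mnm1E eqxx mul1n.
    by apply/mnmP => j; rewrite mulmnE mnm1E !ord1 eqxx mul1n.
  have [lt|ge] := ltnP (m ord0) (size p); last first.
    rewrite nth_default // big1 // => i _; rewrite eqm.
    by rewrite ltn_eqF ?mulr0 // (leq_trans (ltn_ord i)).
  rewrite (bigD1 (Ordinal lt)) //= eqm eqxx mulr1 big1 ?addr0 // => i ne.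
  by rewrite eqm -[i == _ :> nat]/(i == Ordinal lt) (negPf ne) mulr0.
have [||a [fa _]] := bl 0%N f 1; last 2 first.
- exact: oner_neq0.
- exists a; move: fa; rewrite /f raddf_sum /= => fa.
  rewrite rootE horner_coef -[X in _ == X]fa.
  by apply/eqP/eq_bigr => i _; rewrite mevalZ rmorphXn /= mevalXU /jet.
exists (U_(ord0) *+ (size p).-1)%MM.
  rewrite mcoeff_msupp fE mulmnE mnm1E eqxx mul1n -/(lead_coef p) lead_coef_eq0.
  by rewrite -size_poly_gt0 ltnW.
by rewrite mulmnE mnm1E (ord1 ord_max) eqxx mul1n -lt0n -ltnS prednK // ltnW.
Qed.

Lemma cubic_split (U : fieldType) (p : {poly U}) :
  (forall q : {poly U}, (1 < size q)%N -> exists x, root q x) ->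
  size p = 4%N -> exists l a1 a2 a3,
    p = l%:P * (('X - a1%:P) * ('X - a2%:P) * ('X - a3%:P)).
Proof.
move=> closedU.
have step (q : {poly U}) n : size q = n.+2 ->
    exists2 r : {poly U}, size r = n.+1 & exists x, q = r * ('X - x%:P).
  move=> sq; have [|x /factor_theorem[r er]] := closedU q; first by rewrite sq.
  exists r; last by exists x.
  have r0 : r != 0 by apply/eqP=> r0; move: sq; rewrite er r0 mul0r size_poly0.
  by move: sq; rewrite er size_Mmonic ?monicXsubC // size_XsubC addn2 => -[].
move=> /step[q2 /step[q1 /step[q0 /eqP/size_poly1P[l _ ->] [a1 ->]] [a2 ->]] [a3 ->]].
by exists l, a1, a2, a3; rewrite !mulrA.
Qed.

Section Cubic.
Variables (U : fieldType) (pchar0 : [pchar U] =i pred0).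

(** The form x^2 + xy + y^2 is anisotropic over the rationals: it takes a
    positive integer value here, which is seen by rewriting
    d^2 - dm + m^2 as a form with positive coefficients in the smaller of d and
    m and their difference. *)
Lemma quadratic_form_neq0 i j m : (0 < m)%N ->
  (i%:R - j%:R) ^+ 2 + (i%:R - j%:R) * m%:R + m%:R ^+ 2 != 0 :> U.
Proof.
have pos (d e : nat) : (0 < d)%N || (0 < e)%N ->
    d%:R ^+ 2 + d%:R * e%:R + e%:R ^+ 2 != 0 :> U.
  move=> de; rewrite -!natrX -natrM -!natrD natr_eq0_pchar0 //.
  rewrite !addn_eq0 !expn_eq0 !andbT !negb_and.
  by move: de; rewrite !lt0n => /orP[->|->]; rewrite ?orbT.
move=> m0; have [ji|/ltnW ij] := leqP j i.
  by rewrite -natrB // pos // m0 orbT.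
rewrite -opprB -natrB //; move: (j - i)%N => d.
have [md|dm] := leqP m d.
  have := pos m (d - m)%N; rewrite m0 => /(_ isT); apply: contraNneq => <-.
  by rewrite natrB //; apply/eqP; ring.
have := pos d (m - d)%N; rewrite (subn_gt0 d m) dm orbT => /(_ isT).
apply: contraNneq => <-.
by rewrite natrB ?(ltnW dm) //; apply/eqP; ring.
Qed.

(** Centre the roots at their mean: b_i = a_i - e1/3.  With N = i - j and
    M = m, the relation between the multipliers becomes
    (2N + M) b_1 + (N + 2M) b_2 = 0, while b_1^2 + b_1 b_2 + b_2^2 = e1^2/3 - e2
    lies in E.  Eliminating b_2 gives b_1^2 as an element of E, the division
    being by 3 (N^2 + NM + M^2).  Only the coefficients of positive degree are
    taken in E, since the constant coefficient carries the generic parameter. *)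
Lemma cubic_root_algebraic (E : divringClosed U) (Q : {poly U}) l a1 a2 a3 i j m :
  Q = l%:P * (('X - a1%:P) * ('X - a2%:P) * ('X - a3%:P)) ->
  (forall n, Q`_n.+1 \in E) -> Q^`().[a1] != 0 -> (0 < m)%N ->
  Q^`().[a1] *+ i = Q^`().[a1] *+ j + Q^`().[a2] *+ m ->
  algebraicOver (inclusion E) a1.
Proof.
move=> eQ QE.
have dQ1 : Q^`().[a1] = l * (a1 - a2) * (a1 - a3).
  rewrite eQ !derivM !derivB !derivX !derivC.
  by rewrite !(hornerD, hornerN, hornerM, hornerX, hornerC); ring.
have dQ2 : Q^`().[a2] = l * (a2 - a1) * (a2 - a3).
  rewrite eQ !derivM !derivB !derivX !derivC.
  by rewrite !(hornerD, hornerN, hornerM, hornerX, hornerC); ring.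
rewrite dQ1 dQ2 !mulf_eq0 !negb_or -andbA => /and3P[l0 a12 a13] m0 rel.
pose e1 := a1 + a2 + a3; pose e2 := a1 * a2 + a1 * a3 + a2 * a3.
have eQ' : Q = l *: 'X^3 + (- (l * e1)) *: 'X^2 + (l * e2) *: 'X
    + (- (l * (a1 * a2 * a3)))%:P.
  rewrite eQ /e1 /e2 -!mul_polyC !(polyCN, polyCM, polyCD); ring.
have cQ n : Q`_n = l * (n == 3)%:R - l * e1 * (n == 2)%:R + l * e2 * (n == 1)%:R
    - l * (a1 * a2 * a3) * (n == 0)%:R.
  by rewrite eQ' !(coefD, coefZ, coefXn, coefX, coefC); case: n => [|n] /=; ring.
have lE : l \in E by have := QE 2; rewrite cQ /= !mulr0 !subr0 mulr1 addr0.
have e1E : e1 \in E.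
  have -> : e1 = - Q`_2 / Q`_3 by rewrite !cQ /=; field.
  by rewrite rpred_div ?rpredN.
have e2E : e2 \in E.
  have -> : e2 = Q`_1 / Q`_3 by rewrite !cQ /=; field.
  by rewrite rpred_div ?rpredN.
pose N : U := i%:R - j%:R; pose M : U := m%:R.
have r0 : (N + N + M) * a1 + (N + M + M) * a2 - (N + M) * e1 = 0.
  have u0 : l * (a1 - a2) != 0 by rewrite mulf_neq0.
  apply: (mulfI u0); apply/eqP; rewrite -subr_eq0; apply/eqP.
  transitivity (l * (a1 - a2) * (a1 - a3) *+ i -
    (l * (a1 - a2) * (a1 - a3) *+ j + l * (a2 - a1) * (a2 - a3) *+ m)).
    rewrite /N /M /e1; ring.
  by rewrite rel subrr.
have z0 : N ^+ 2 + N * M + M ^+ 2 != 0 by exact: quadratic_form_neq0.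
have three0 : 3%:R != 0 :> U by rewrite natr_eq0_pchar0.
pose w := - ((N + M + M) ^+ 2 * (e2 - e1 ^+ 2 / 3%:R)) / (3%:R * (N ^+ 2 + N * M + M ^+ 2)).
have wE : w \in E.
  have [NE ME] : N \in E /\ M \in E by rewrite /N /M rpredB ?rpred_nat.
  have sE : N + M + M \in E by apply: rpredD => //; apply: rpredD.
  have tE : e2 - e1 ^+ 2 / 3%:R \in E.
    by apply: rpredB => //; apply: rpred_div; rewrite ?rpred_nat ?rpredX.
  have zE : N ^+ 2 + N * M + M ^+ 2 \in E.
    by do 2?apply: rpredD; rewrite ?rpredX ?rpredM.
  by apply: rpred_div; [rewrite rpredN rpredM ?rpredX | rewrite rpredM ?rpred_nat].
have bw : (a1 - e1 / 3%:R) ^+ 2 = w.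
  apply/eqP; rewrite -subr_eq0 /w.
  set r := _ - _ in r0.
  (* The elimination of b_2: b_1^2 - w is a multiple of the relation r = 0. *)
  have -> : (a1 - e1 / 3%:R) ^+ 2 - w = r * ((N + N + M) * (a1 - e1 / 3%:R)
       - (N + M + M) * (a1 + a2 - (e1 + e1) / 3%:R)) / (3%:R * (N ^+ 2 + N * M + M ^+ 2)).
    rewrite /r /w /e1 /e2; field.
    by rewrite z0 three0.
  by rewrite r0 !mul0r.
have -> : a1 = (a1 - e1 / 3%:R) + e1 / 3%:R by rewrite subrK.
apply: algebraic_add; last first.
  by apply: algebraic_base; rewrite rpred_div ?rpred_nat.
apply/algebraicOverP; exists ('X^2 - w%:P); split.
- by rewrite rpredB ?polyOverXn ?polyOverC.
- by rewrite -size_poly_gt0 size_XnsubC.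
- by rewrite rootE !hornerE bw subrr.
Qed.
End Cubic.

(** * Constants in the field generated by a solution *)

Section Generated.
Variables (U : fieldType) (delta : {additive U -> U}).
Hypothesis delta_leibniz : leibniz delta.
Variables (F : set U) (hF : subfield_set F) (F_delta : forall x, F x -> F (delta x)).
Local Notation E := (subfield_pred hF).

Lemma flow_der_over (Q f : {poly U}) : Q \is a polyOver E -> f \is a polyOver E ->
  flow_der delta Q f \is a polyOver E.
Proof.
move=> QE fE; rewrite rpredD ?rpredM ?polyOver_deriv //.
apply/polyOverP => i; rewrite coef_map; apply/subfield_predE/F_delta/subfield_predE.
exact/polyOverP.
Qed.

(** As a' = Q(a) lies in F(a), the field F(a) is already closed under delta. *)
Lemma gen_dfield_fractions (Q : {poly U}) a : Q \is a polyOver E -> delta a = Q.[a] ->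
  gen_dfield delta (F `|` [set a]) `<=` fractions E a.
Proof.
move=> QE da; apply: smallest_sub; last first.
  by move=> x [/subfield_predE xF|->]; [apply: fractions_base|apply: fractions_gen].
split=> [|_ [f [g [fE gE g0 ->]]]]; first exact: fractions_subfield.
exists (wronskian delta Q f g), (g ^+ 2); split.
- by rewrite rpredB // rpredM // flow_der_over.
- by rewrite rpredX.
- by rewrite horner_exp expf_neq0.
- rewrite horner_exp /wronskian hornerD hornerN !hornerM !flow_der_horner //.
  by rewrite delta_leibniz deltaV //; field.
Qed.

(** The relation (f(a)/g(a))' = 0 is polynomial in a over F; as a is
    transcendental over F, it holds identically. *)
Lemma first_integral_of_new_constant (Q : {poly U}) a k :
  Q \is a polyOver E -> delta a = Q.[a] ->
  gen_dfield delta (F `|` [set a]) k -> delta k = 0 ->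
  ~ algebraicOver (inclusion E) k ->
  exists f g, first_integral delta Q f g.
Proof.
move=> QE da /(gen_dfield_fractions QE da) kEa dk kna.
have ana : ~ algebraicOver (inclusion E) a.
  by move=> aE; apply: kna; apply: algebraic_fractions kEa.
have [f [g [fE gE g0 ek]]] := kEa.
exists f, g; split; first by apply: contraNneq g0 => ->; rewrite horner0.
  move=> c fg; apply: kna.
  have gl : lead_coef g != 0.
    by rewrite lead_coef_eq0; apply: contraNneq g0 => ->; rewrite horner0.
  have -> : k = f`_(size g).-1 / g`_(size g).-1.
    by rewrite ek fg hornerZ coefZ !mulfK.
  by apply: algebraic_base; rewrite rpred_div //; apply/polyOverP.
have [//|w0] := eqVneq (wronskian delta Q f g) 0; exfalso; apply: ana.
apply/algebraicOverP; exists (wronskian delta Q f g); split=> //.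
  by rewrite rpredB // rpredM // flow_der_over.
rewrite rootE /wronskian hornerD hornerN !hornerM !flow_der_horner // subr_eq0.
by rewrite -delta_div_const // -ek dk.
Qed.
End Generated.

Theorem corollary7p12 (U : fieldType) (delta : {additive U -> U})
    (hU : DCF0_model delta) (hsat : saturated delta)
    (P : {poly U}) (hP : coefs P `<=` constants delta) (hdeg : size P = 4%N)
    (c : U) (hc : constants delta c) (hgen : generic_over P c) :
  orthogonal_to_constants delta P c.
Proof.
case: hU => pchar0 leib bl [F [[hF Fd] genF _ [a [da [k [kFa dk kna]]]]]].
pose Q := P + c%:P.
pose C := subfield_pred (constants_divring_closed leib).
have C_constants x : x \in C <-> delta x = 0 by exact: subfield_predE.
have cF : F c by apply: genF; apply: sub_gen_smallest; left.
have PF i : F P`_i by apply: genF; apply: sub_gen_smallest; right; exists i.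
have QF : Q \is a polyOver (subfield_pred hF).
  apply: rpredD; first by apply/polyOverP => i; apply/subfield_predE.
  by rewrite polyOverC; apply/subfield_predE.
have QC : Q \is a polyOver C.
  apply: rpredD; first by apply/polyOverP => i; apply/C_constants/hP; exists i.
  by rewrite polyOverC; apply/C_constants.
have [f [g fg]] : exists f g, first_integral delta Q f g.
  apply: (first_integral_of_new_constant leib Fd QF) kFa dk _; first by rewrite da !hornerE.
  by move/algebraicOverP.
have hF0 := gen_field_subfield (coefs P); set F0 := gen_field _ in hF0.
pose E := subfield_pred hF0.
have PE : P \is a polyOver E.
  by apply/polyOverP => i; apply/subfield_predE; apply: sub_gen_smallest; exists i.
have cE : ~ algebraicOver (inclusion E) c by move/algebraicOverP.
have root_transc x : root Q x -> ~ algebraicOver (inclusion E) x.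
  rewrite rootE /Q hornerD hornerC addrC addr_eq0 => /eqP cx xE; apply: cE; rewrite cx.
  by apply: algebraic_opp; apply: algebraic_horner.
have dQ : Q^`() = P^`() by rewrite derivD derivC addr0.
(* A multiple root is a root of Q' = P', which is free of c. *)
have simple x : root Q x -> Q^`().[x] != 0.
  move=> Qx; apply/eqP => Q'x; apply: (root_transc x Qx); apply/algebraicOverP.
  exists Q^`(); rewrite dQ polyOver_deriv //; split=> //; last by rewrite -dQ; apply/rootP.
  apply/eqP => /(congr1 (fun p : {poly U} => p`_2)); rewrite coef_deriv coef0 => /eqP.
  rewrite -mulr_natr mulf_eq0 natr_eq0_pchar0 // orbF.
  have -> : P`_3 = lead_coef P by rewrite /lead_coef hdeg.
  by rewrite lead_coef_eq0 -size_poly_eq0 hdeg.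
have constr x : root Q x -> x \in C.
  move=> Qx; apply/C_constants; apply: (mulfI (simple x Qx)).
  by rewrite mulr0 -(delta_horner_over leib C_constants) // (rootP Qx) raddf0.
have sQ : size Q = 4 by rewrite size_polyDl // hdeg ltnS (leq_trans (size_polyC_leq1 _)).
have [l [a1 [a2 [a3 eQ]]]] := cubic_split (blum_root bl) sQ.
have r1 : root Q a1.
  rewrite /root eQ !(hornerM, hornerD, hornerN, hornerX, hornerC).
  by rewrite subrr !(mul0r, mulr0).
have r2 : root Q a2.
  rewrite /root eQ !(hornerM, hornerD, hornerN, hornerX, hornerC).
  by rewrite subrr !(mul0r, mulr0).
have [i [j [n rel]]] := first_integral_multipliers leib pchar0 (blum_root bl) C_constants
  QC (constr _ r1) (constr _ r2) r1 r2 (simple _ r1) fg.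
apply: (root_transc a1 r1).
apply: (cubic_root_algebraic pchar0 eQ _ (simple _ r1) (ltn0Sn n) rel) => m.
by rewrite coefD coefC addr0; apply/polyOverP.
Qed.
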